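(* Let $i\ge 0$ be an integer. Every $\mathrm{Inc}(\mathbb{N})^i$-invariant filtration (chain) $\mathcal{I}=(I_n)_{n\in\mathbb{N}}$ stabilizes.
   Context: $K$ is an arbitrary field, $c\ge 1$ a fixed integer, $\mathbb{N}=\{1,2,\ldots\}$. For $n\in\mathbb{N}$ let $X_n=\{x_{j,k}\mid 1\le j\le c,\ 1\le k\le n\}$ and $X=\bigcup_{n\ge1}X_n$; $K[X_n]\subset K[X]$ are the polynomial rings over $K$. $\mathrm{Inc}(\mathbb{N})$ is the monoid of strictly increasing functions $\mathbb{N}\to\mathbb{N}$; for $i\ge 0$, $\mathrm{Inc}(\mathbb{N})^i=\{\pi\in\mathrm{Inc}(\mathbb{N})\mid \pi(j)=j \text{ for all } j\le i\}$, acting on $K[X]$ by $K$-algebra homomorphisms via $\pi\cdot x_{j,k}=x_{j,\pi(k)}$. For $m\le n$ put $\mathrm{Inc}(\mathbb{N})^i_{m,n}=\{\pi\in\mathrm{Inc}(\mathbb{N})^i\mid\pi(m)\le n\}$. An $\mathrm{Inc}(\mathbb{N})^i$-invariant filtration (or chain) is a sequence $\mathcal{I}=(I_n)_{n\in\mathbb{N}}$ of ideals $I_n\subset K[X_n]$ such that $\mathrm{Inc}(\mathbb{N})^i_{m,n}(I_m)\subset I_n$ whenever $m\le n$. It stabilizes if there is an integer $r\ge1$ such that $\langle\mathrm{Inc}(\mathbb{N})^i_{r,n}(I_r)\rangle_{K[X_n]}=I_n$ for all $n\ge r$. *)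

(* Defs.v *)
From mathcomp Require Import all_boot all_algebra finmap.
From mathcomp.multinomials Require Import monalg.

Set Implicit Arguments.
Unset Strict Implicit.
Unset Printing Implicit Defensive.

Import GRing.Theory.
Local Open Scope ring_scope.

(* Rows 1..c and columns 1, 2, ... are numbered from 0: the pair (j, k)
   stands for the variable x_{j+1,k+1}.  Likewise an element pi of Inc(N) is
   represented by k |-> pi(k+1) - 1.  The subscripts of X_n and I_n are sizes
   and are not shifted. *)
Notation Xvar c := ('I_c * nat)%type.
Notation Xmonom c := {cmonom (Xvar c)}.
Notation KX K c := {malg K[Xmonom c]}.

Definition xvar (K : fieldType) (c : nat) (v : Xvar c) : KX K c :=
  << ucm v >>.

(* The subring K[X_n] of K[X]: the monomials of f only involve variables from
   the first n columns. *)
Definition in_KXn (K : fieldType) (c n : nat) (f : KX K c) : Prop :=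
  forall (m : Xmonom c) (v : Xvar c),
    m \in msupp f -> m v != 0%N -> (v.2 < n)%N.

(* Ideals of a subring A of R, not necessarily proper. *)
Definition ideal_of (R : comNzRingType) (A I : R -> Prop) : Prop :=
  [/\ forall x, I x -> A x,
      I 0,
      forall x y, I x -> I y -> I (x + y) &
      forall a x, A a -> I x -> I (a * x)].

Definition ideal_gen (R : comNzRingType) (A S : R -> Prop) : R -> Prop :=
  fun x => forall J, ideal_of A J -> (forall s, S s -> J s) -> J x.

(* Inc(N)^i *)
Definition Inc (i : nat) (pi : nat -> nat) : Prop :=
  {homo pi : j k / (j < k)%N} /\ forall j, (j < i)%N -> pi j = j.

(* Inc(N)^i_{m,n} for m >= 1: column m is numbered m.-1, so pi(m) <= n reads
   pi m.-1 < n. *)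
Definition Inc_mn (i m n : nat) (pi : nat -> nat) : Prop :=
  Inc i pi /\ (pi m.-1 < n)%N.

(* The action on K[X]: substitution of x_{j,pi(k)} for x_{j,k}. *)
Definition Inc_act (K : fieldType) (c : nat) (pi : nat -> nat) (f : KX K c) :
    KX K c :=
  mmap (@mkmalgU (Xmonom c) K mone)
    (fun m : Xmonom c =>
       \prod_(v <- finsupp (cmonom_val m)) xvar K (v.1, pi v.2) ^+ m v) f.

Definition Inc_image (K : fieldType) (c i m n : nat) (I : KX K c -> Prop) :
    KX K c -> Prop :=
  fun g => exists pi f, [/\ Inc_mn i m n pi, I f & g = Inc_act pi f].

(* Only the terms with n >= 1 of the sequences below are meaningful. *)
Definition Inc_filtration (K : fieldType) (c i : nat)
    (I : nat -> KX K c -> Prop) : Prop :=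
  (forall n, (0 < n)%N -> ideal_of (@in_KXn K c n) (I n)) /\
  (forall m n, (0 < m)%N -> (m <= n)%N ->
     forall g, Inc_image i m n (I m) g -> I n g).

Definition stabilizes (K : fieldType) (c i : nat)
    (I : nat -> KX K c -> Prop) : Prop :=
  exists r, (0 < r)%N /\
    forall n, (r <= n)%N ->
      forall g, ideal_gen (@in_KXn K c n) (Inc_image i r n (I r)) g <-> I n g.

(* Main.v *)
Require Import Defs.
From mathcomp Require Import all_boot all_algebra finmap.
From mathcomp.multinomials Require Import monalg.
From mathcomp Require Import boolp zify.

(** Groebner bases up to the action of Inc(N)^i, with noetherianity supplied by
    Higman's lemma.

    Order the monomials of K[X] colexicographically, comparing the exponents of
    the last variable, by column first, at which two monomials differ
    ([colex]).  This is a well-founded total order compatible with products,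
    and it is preserved by every increasing substitution of columns
    ([colex_act]).  Hence, if f has leading monomial u, then pi.f has leading
    monomial pi.u for all pi in Inc(N)^i ([leading_act]).

    Say that (m, u) divides (n, v) if pi.u divides v for some pi in
    Inc(N)^i_{m,n}.  Reading a monomial of K[X_n] as a word of length n, whose
    k-th letter lists the c exponents in column k, this says that the letters
    in the first i columns of u are below those of v, and that the rest of u
    embeds, letterwise below, into the rest of v.  By Dickson's lemma on the
    letters and the fixed prefix, and Higman's lemma on the remaining word,
    every sequence of pairs contains one that divides a later one ([Inc_wqo]).
    The sizes m and n belong to the pairs because I_n may be strictly smaller
    than the trace on K[X_n] of the union of the chain, so noetherianity of
    that union up to symmetry would not be enough.

    It follows that some r is such that every leading term of the chain, of
    whatever size n, is divided by one of size at most r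
    ([leading_terms_bounded]).  For n >= r, take f in I_n with leading monomial
    v.  A leading term (m, u) with m <= r, that of some f0 in I_m, divides
    (n, v) via some pi; a multiple of pi.f0 cancels the leading monomial of f,
    and well-founded induction on v applies to the difference.  The polynomial
    pi.f0 lies in the ideal generated by the images of I_r because pi factors
    as sigma o tau with tau in Inc(N)^i_{m,r} and sigma in Inc(N)^i_{r,n}
    ([Inc_mn_factor]), and tau.f0 is in I_r. *)

Set Implicit Arguments.
Unset Strict Implicit.
Unset Printing Implicit Defensive.

(** * Well-quasi-orders *)

Definition increasing (h : nat -> nat) : Prop := {homo h : j k / (j < k)%N}.

Definition good (A : Type) (R : A -> A -> Prop) (f : nat -> A) : Prop :=
  exists a b, (a < b)%N /\ R (f a) (f b).

(** The strong form of being a well-quasi-order: a monotone infinite subsequence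
    in place of a single pair.  The two forms are equivalent for preorders, but
    only this one passes to conjunctions by merely extracting twice. *)
Definition has_chains (A : Type) (R : A -> A -> Prop) : Prop :=
  forall f : nat -> A, exists h, increasing h /\
    forall a b, (a < b)%N -> R (f (h a)) (f (h b)).

Lemma increasing_step (h : nat -> nat) :
  (forall k, h k < h k.+1)%N -> increasing h.
Proof. by move=> hS; apply: homo_ltn => // y x z; apply: ltn_trans. Qed.

Lemma increasing_leq (h : nat -> nat) :
  increasing h -> {homo h : j k / (j <= k)%N}.
Proof.
move=> h_incr j k; rewrite leq_eqVlt => /predU1P[-> //|/h_incr].
exact: ltnW.
Qed.

Lemma infinitely_often (P : nat -> Prop) :
  (forall n, exists m, (n <= m)%N /\ P m) ->
  exists h, increasing h /\ forall k, P (h k).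
Proof.
move=> /choice[s sP]; pose h := fix h k := if k is l.+1 then s (h l).+1 else s 0.
exists h; split; last by case=> [|k]; apply: (sP _).2.
by apply: increasing_step => k; apply: (sP (h k).+1).1.
Qed.

(** In a sequence of natural numbers there are infinitely many indices after
    which no value is smaller: otherwise the values could be lowered forever.
    The subsequence at these indices is nondecreasing. *)
Lemma has_chains_leq : has_chains leq.
Proof.
move=> f; pose P m := forall k, (m <= k)%N -> (f m <= f k)%N.
have /infinitely_often[h [h_incr hP]] : forall n, exists m, (n <= m)%N /\ P m.
  suff minP v n : (f n <= v)%N -> exists m, (n <= m)%N /\ P m.
    by move=> n; apply: (minP (f n)).
  elim: v n => [|v IHv] n fn.
    by exists n; split=> // k _; move: fn; rewrite leqn0 => /eqP->.
  have [Pn|/existsNP[k /not_implyP[le_nk /negP]]] := pselect (P n).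
    by exists n.
  rewrite -ltnNge => fk.
  have [|m [le_km Pm]] := IHv k; first by rewrite -ltnS (leq_trans fk).
  by exists m; split=> //; apply: leq_trans le_km.
by exists h; split=> // a b /h_incr/ltnW; apply: hP.
Qed.

Lemma has_chains_preim (A B : Type) (phi : A -> B) (R : B -> B -> Prop) :
  has_chains R -> has_chains (fun x y => R (phi x) (phi y)).
Proof. by move=> chR f; apply: (chR (phi \o f)). Qed.

Lemma has_chains_and (A : Type) (R S : A -> A -> Prop) :
  has_chains R -> has_chains S -> has_chains (fun x y => R x y /\ S x y).
Proof.
move=> chR chS f; have [h [h_incr hR]] := chR f.
have [g [g_incr gS]] := chS (f \o h).
exists (h \o g); split=> [a b ab|a b lt_ab]; first exact/h_incr/g_incr.
by split; [apply/hR/g_incr|apply: gS].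
Qed.

(** With [has_chains_leq], this contains Dickson's lemma: take for [R t] the
    comparison of the t-th coordinates. *)
Lemma has_chains_forall (T : finType) (A : Type) (R : T -> A -> A -> Prop) :
  (forall t, has_chains (R t)) -> has_chains (fun x y => forall t, R t x y).
Proof.
move=> chR.
suff chs (s : seq T) : has_chains (fun x y => forall t, t \in s -> R t x y).
  move=> f; have [h [h_incr hR]] := chs (enum T) f; exists h; split=> // a b ab t.
  by apply: hR => //; rewrite mem_enum.
elim: s => [|t s IHs] f; first by exists id; split.
have [h [h_incr hR]] := has_chains_and (chR t) IHs f; exists h; split=> // a b ab u.
by rewrite inE => /predU1P[->|]; case: (hR a b ab) => // _; apply.
Qed.

(** * Higman's lemma *)

(** The Nash-Williams construction.  The terms are chosen one after the other,
    each of least size among those that extend the terms already chosen to a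
    bad sequence.  The state carried along is a whole bad sequence, so that
    such an extension is always at hand. *)
Lemma minimal_bad_sequence (W : Type) (E : W -> W -> Prop) (size : W -> nat) :
  (exists f, ~ good E f) ->
  exists f, ~ good E f /\
    forall k g, ~ good E g -> (forall l, (l < k)%N -> g l = f l) ->
      (size (f k) <= size (g k))%N.
Proof.
move=> [f0 f0_bad].
(* The next state keeps the terms before k and has a k-th term of least size. *)
pose next k (g g' : {f | ~ good E f}) :=
  (forall l, (l < k)%N -> sval g' l = sval g l) /\
  forall g'' : {f | ~ good E f}, (forall l, (l < k)%N -> sval g'' l = sval g l) ->
    (size (sval g' k) <= size (sval g'' k))%N.
have /choice[s sP] (kg : nat * {f | ~ good E f}) : exists g', next kg.1 kg.2 g'.
  case: kg => k g /=.
  pose Q v := exists2 g' : {f | ~ good E f},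
    (forall l, (l < k)%N -> sval g' l = sval g l) & size (sval g' k) = v.
  have exQ : exists v, `[< Q v >] by exists (size (sval g k)); apply/asboolP; exists g.
  case: (ex_minnP exQ) => v /asboolP[g' g'g g'v] vmin; exists g'; split=> // g'' g''g.
  by rewrite g'v; apply/vmin/asboolP; exists g''.
pose G := fix G k := if k is l.+1 then s (l, G l) else exist _ f0 f0_bad.
(* Later stages never revise the k-th term once it is chosen at stage k.+1. *)
pose f k := sval (G k.+1) k.
have Gf d k l : (l < k)%N -> sval (G (k + d)%N) l = sval (G k) l.
  elim: d => [|d IHd] lk; first by rewrite addn0.
  by rewrite addnS /= (sP _).1 ?IHd //= ltn_addr.
have fG k l : (l < k)%N -> f l = sval (G k) l.
  by move=> lk; rewrite -(subnKC lk) Gf.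
exists f; split=> [[a [b [ab]]]|k g g_bad gf].
  rewrite (fG b.+1 a (leqW ab)) (fG b.+1 b (ltnSn b)) => Eab.
  by apply: (svalP (G b.+1)); exists a, b.
apply: ((sP (k, G k)).2 (exist _ g g_bad)) => l lk /=.
by rewrite gf // (fG k).
Qed.

(** A word of length n is represented by n and a function on all indices, whose
    values from n on are junk.  An embedding of words then extends to an
    increasing function of all natural numbers, as for the elements of Inc(N). *)
Definition embeds (A : Type) (R : A -> A -> Prop) (w w' : nat * (nat -> A)) :
    Prop :=
  exists p, increasing p /\
    forall k, (k < w.1)%N -> (p k < w'.1)%N /\ R (w.2 k) (w'.2 (p k)).

Definition behead_word (A : Type) (w : nat * (nat -> A)) : nat * (nat -> A) :=
  (w.1.-1, fun k => w.2 k.+1).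

Lemma embeds_behead (A : Type) (R : A -> A -> Prop) (w w' : nat * (nat -> A)) :
  embeds R w (behead_word w') -> embeds R w w'.
Proof.
move=> [p [p_incr pP]]; exists (fun k => (p k).+1); split=> [j k /p_incr //|k kw].
by have [/= pk ?] := pP k kw; split=> //; lia.
Qed.

Lemma embeds_cons (A : Type) (R : A -> A -> Prop) (w w' : nat * (nat -> A)) :
  (0 < w'.1)%N -> R (w.2 0) (w'.2 0) ->
  embeds R (behead_word w) (behead_word w') -> embeds R w w'.
Proof.
move=> w'_gt0 R0 [p [p_incr pP]].
exists (fun k => if k is l.+1 then (p l).+1 else 0); split.
  by case=> [|j] [|k] //; rewrite !ltnS => /p_incr.
case=> [//|k kw]; have [|/= pk ?] := pP k; first by rewrite /=; lia.
by split=> //; lia.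
Qed.

(** From a minimal bad sequence, extract a subsequence with monotone first
    letters, starting at index [h 0], and replace the terms from [h 0] on by the
    tails of this subsequence.  The new sequence is still bad, since embeddings
    of tails lift to the words, yet its term at [h 0] is shorter. *)
Theorem Higman (A : Type) (R : A -> A -> Prop) :
  has_chains R -> forall f, good (embeds R) f.
Proof.
move=> chR; apply: contrapT => /existsNP nall.
have [f [f_bad fmin]] := minimal_bad_sequence (fun w => w.1) nall.
(* The empty word embeds in everything, so it does not occur in f. *)
have f_gt0 a : (0 < (f a).1)%N.
  case: posnP => // fa0; case: f_bad; exists a, a.+1; split=> //.
  by exists id; split=> // k; rewrite fa0.
have [h [h_incr hR]] := chR (fun a => (f a).2 0).
pose g a := if (a < h 0)%N then f a else behead_word (f (h (a - h 0)%N)).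
suff g_bad : ~ good (embeds R) g.
  have gf l : (l < h 0)%N -> g l = f l by move=> lt_l; rewrite /g lt_l.
  have := fmin (h 0) g g_bad gf; have := f_gt0 (h 0).
  by rewrite /g ltnn subnn /=; case: (f (h 0)).1 => // n; rewrite ltnn.
move=> [a [b [ab]]]; rewrite /g; case: ltnP => [ah|ha]; case: ltnP => [bh|hb] E; apply: f_bad.
- by exists a, b.
- exists a, (h (b - h 0)%N); split; last exact: embeds_behead.
  by apply: leq_trans ah _; apply: increasing_leq.
- lia.
- exists (h (a - h 0)%N), (h (b - h 0)%N); have lt_ab : (a - h 0 < b - h 0)%N by lia.
  by split; [apply: h_incr|apply: embeds_cons => //; apply: hR].
Qed.

(** * The monoids of increasing maps *)

Lemma Inc_increasing (i : nat) (pi : nat -> nat) : Inc i pi -> increasing pi.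
Proof. by case. Qed.

(** The inner factor follows pi as long as pi shifts by at most r - m, the slack
    available in size r, and shifts by exactly r - m afterwards.  Since the shift
    pi k - k never decreases, the outer factor can restore the missing part. *)
Lemma Inc_mn_factor (i m r n : nat) (pi : nat -> nat) :
  (0 < m)%N -> (m <= r)%N -> (r <= n)%N -> Inc_mn i m n pi ->
  exists sigma tau, [/\ Inc_mn i m r tau, Inc_mn i r n sigma &
    forall k, pi k = sigma (tau k)].
Proof.
move=> m_gt0 le_mr le_rn [[pi_incr pi_fix] pi_lt].
pose tau k := minn (pi k) (r - m + k).
pose sigma j := if (r - m <= j)%N then maxn j (pi (j - (r - m))%N) else j.
have pi_leq := increasing_leq pi_incr.
exists sigma, tau; split.
- split; last by rewrite /tau; lia.
  split=> [j k jk|j ji]; first by have := pi_incr _ _ jk; rewrite /tau; lia.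
  by rewrite /tau pi_fix //; lia.
- split.
    split=> [j k jk|j ji]; rewrite /sigma.
      case: (leqP (r - m) j) => rj; case: (leqP (r - m) k) => rk; try lia.
      have /pi_incr : (j - (r - m) < k - (r - m))%N by lia.
      lia.
    by case: ifP => // rj; rewrite pi_fix; lia.
  rewrite /sigma ifT; last by lia.
  by rewrite (_ : (r.-1 - (r - m))%N = m.-1); lia.
move=> k; rewrite /tau /sigma; case: (leqP (pi k) (r - m + k)) => le_pi.
  case: ifP => // le_r.
  by apply/esym/maxn_idPl/pi_leq; lia.
by rewrite leq_addr addKn; lia.
Qed.

(** Along a subsequence the sizes and the first i columns, which elements of
    Inc(N)^i fix, are nondecreasing, by Dickson's lemma.  Higman's lemma then
    handles the remaining columns, and pi glues the identity on the first i
    columns to the embedding it returns. *)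
Lemma Inc_wqo (c i : nat) (f : nat -> nat * Xmonom c) :
  (forall a, 0 < (f a).1)%N ->
  (forall a v, (f a).2 v != 0 -> v.2 < (f a).1)%N ->
  exists a b, (a < b)%N /\ exists pi, Inc_mn i (f a).1 (f b).1 pi /\
    forall v, ((f a).2 v <= (f b).2 (v.1, pi v.2))%N.
Proof.
move=> f_gt0 f_supp.
have chR : has_chains (fun x y : nat * Xmonom c => (x.1 <= y.1)%N /\
    forall v : 'I_c * 'I_i, (x.2 (v.1, val v.2) <= y.2 (v.1, val v.2))%N).
  apply: has_chains_and; first exact: (has_chains_preim fst has_chains_leq).
  apply: has_chains_forall => v.
  exact: (has_chains_preim (fun x : nat * Xmonom c => x.2 (v.1, val v.2)) has_chains_leq).
have [h [h_incr hR]] := chR f.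
have chS : has_chains (fun x y : 'I_c -> nat => forall j, (x j <= y j)%N).
  apply: has_chains_forall => j.
  exact: (has_chains_preim (fun x : 'I_c -> nat => x j) has_chains_leq).
pose w a := (((f (h a)).1 - i)%N, fun k j => (f (h a)).2 (j, (i + k)%N)).
have [a [b [lt_ab [p [p_incr pP]]]]] := Higman chS w.
have [le_n le_pre] := hR a b lt_ab.
exists (h a), (h b); split; first exact: h_incr.
pose pi k := if (k < i)%N then k else (i + p (k - i))%N.
exists pi; split; first split; first split.
- move=> j k jk; rewrite /pi; case: (ltnP j i) => ji; case: (ltnP k i) => ki; try lia.
  have /p_incr : (j - i < k - i)%N by lia.
  lia.
- by move=> j ji; rewrite /pi ji.
- have n_gt0 := f_gt0 (h a); rewrite /pi; case: (ltnP _ i) => ni; first by lia.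
  have [|/= ? _] := pP ((f (h a)).1.-1 - i)%N; rewrite /=; lia.
(* Beyond its size a word is junk, but there the monomial has exponent 0. *)
case=> j k /=; rewrite /pi; case: (ltnP k i) => [ki|ik].
  exact: (le_pre (j, Ordinal ki)).
have [->//|/f_supp/= kn] := eqVneq ((f (h a)).2 (j, k)) 0.
have [|/= _ /(_ j)] := pP (k - i)%N; first by rewrite /=; lia.
by rewrite subnKC.
Qed.

(** * The action on monomials and polynomials *)

Import GRing.Theory.
Local Open Scope ring_scope.

Definition rename (c : nat) (pi : nat -> nat) (v : Xvar c) : Xvar c :=
  (v.1, pi v.2).

Definition monom_act (c : nat) (pi : nat -> nat) (m : Xmonom c) : Xmonom c :=
  \big[mmul/mone]_(v <- finsupp (cmonom_val m))
    iter (m v) (mmul (ucm (rename pi v))) mone.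

Lemma monom_actE (c : nat) (pi : nat -> nat) (m : Xmonom c) (w : Xvar c) :
  monom_act pi m w =
  (\sum_(v <- finsupp (cmonom_val m)) m v * (rename pi v == w))%N.
Proof.
rewrite /monom_act (big_morph (fun u : Xmonom c => u w) (cmM w) (cm1 w)).
apply: eq_bigr => v _; elim: (m v) => [|e IHe] /=; first by rewrite cm1.
by rewrite cmM IHe cmU mulSn.
Qed.

Lemma rename_inj (c : nat) (pi : nat -> nat) :
  increasing pi -> injective (@rename c pi).
Proof.
move=> pi_incr [j k] [j' k'] [-> eq_pi]; congr pair.
by case: (ltngtP k k') => // /pi_incr; rewrite eq_pi ltnn.
Qed.

Lemma monom_act_rename (c : nat) (pi : nat -> nat) (m : Xmonom c) (v : Xvar c) :
  increasing pi -> monom_act pi m (rename pi v) = m v.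
Proof.
move=> pi_incr; rewrite monom_actE.
under eq_bigr => u _ do rewrite (inj_eq (rename_inj pi_incr)).
have [v_m|v_m] := boolP (v \in finsupp (cmonom_val m)).
  rewrite (big_fsetD1 v) //= eqxx muln1 big_seq big1 ?addn0 // => u.
  by rewrite !inE => /andP[/negPf-> _]; rewrite muln0.
rewrite big_seq big1 => [|u u_m]; first by apply/esym/eqP; rewrite cmE_eq0.
by rewrite (_ : u == v = false) ?muln0 //; apply: contraNF v_m => /eqP<-.
Qed.

Lemma monom_act_eq0 (c : nat) (pi : nat -> nat) (m : Xmonom c) (w : Xvar c) :
  (forall v, rename pi v <> w) -> monom_act pi m w = 0%N.
Proof.
move=> w_out; rewrite monom_actE big1 // => v _.
by rewrite (_ : _ == w = false) ?muln0 //; apply/eqP.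
Qed.

Lemma monom_act_inj (c : nat) (pi : nat -> nat) :
  increasing pi -> injective (@monom_act c pi).
Proof.
move=> pi_incr m m' eq_m; apply/eqP/cmP => v.
by rewrite -(monom_act_rename m v pi_incr) eq_m monom_act_rename.
Qed.

Lemma malgUM (K : fieldType) (M : monomType) (a b : K) (u v : M) :
  << a *g u >> * << b *g v >> = << a * b *g mmul u v >> :> {malg K[M]}.
Proof. exact: fgmulUU. Qed.

Lemma malgUX (K : fieldType) (M : monomType) (u : M) (n : nat) :
  << u >> ^+ n = << iter n (mmul u) mone >> :> {malg K[M]}.
Proof.
elim: n => [|n IHn]; first by rewrite expr0 -mpolyC1E.
by rewrite exprS IHn malgUM mulr1.
Qed.

Lemma malgU_prod (K : fieldType) (M : monomType) (T : Type) (r : seq T)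
    (F : T -> M) :
  \prod_(t <- r) << F t >> = << \big[mmul/mone]_(t <- r) F t >> :> {malg K[M]}.
Proof.
elim/big_rec2: _ => [|t u x _ ->]; first by rewrite -mpolyC1E.
by rewrite malgUM mulr1.
Qed.

Lemma Inc_actE (K : fieldType) (c : nat) (pi : nat -> nat) (f : KX K c) :
  Inc_act pi f = \sum_(m <- msupp f) << f@_m *g monom_act pi m >>.
Proof.
rewrite /Inc_act mmapE; apply: eq_bigr => m _.
under eq_bigr => v _ do rewrite malgUX.
by rewrite malgU_prod malgUM mulr1 mul1m.
Qed.

Lemma mcoeff_Inc_act (K : fieldType) (c : nat) (pi : nat -> nat) (f : KX K c)
    (m : Xmonom c) :
  increasing pi -> (Inc_act pi f)@_(monom_act pi m) = f@_m.
Proof.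
move=> pi_incr; rewrite Inc_actE [in RHS](monalgE f) !raddf_sum /=.
by apply: eq_bigr => u _; rewrite !mcoeffU (inj_eq (monom_act_inj pi_incr)).
Qed.

Lemma msupp_Inc_act (K : fieldType) (c : nat) (pi : nat -> nat) (f : KX K c)
    (u : Xmonom c) :
  u \in msupp (Inc_act pi f) -> exists2 m, m \in msupp f & u = monom_act pi m.
Proof.
rewrite -mcoeff_neq0 Inc_actE raddf_sum /= => u_neq0.
apply: contrapT => /forall2NP no_m; case/eqP: u_neq0.
rewrite big_seq big1 // => m m_f; rewrite mcoeffU.
by case: eqP => // /esym m_u; case: (no_m m).
Qed.

Lemma monom_act_comp (c : nat) (sigma tau pi : nat -> nat) (m : Xmonom c) :
  increasing sigma -> increasing tau -> (forall k, pi k = sigma (tau k)) ->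
  monom_act sigma (monom_act tau m) = monom_act pi m.
Proof.
move=> s_incr t_incr pi_eq.
have pi_incr : increasing pi by move=> j k jk; rewrite !pi_eq; apply/s_incr/t_incr.
have renameE v : rename pi v = rename sigma (rename tau v) :> Xvar c.
  by rewrite /rename pi_eq.
apply/eqP/cmP => w.
have [[v <-]|w_out] := pselect (exists v, rename pi v = w).
  rewrite (monom_act_rename _ _ pi_incr) renameE (monom_act_rename _ _ s_incr).
  exact: monom_act_rename.
have w_pi v : rename pi v <> w by move=> v_w; apply: w_out; exists v.
rewrite [RHS]monom_act_eq0 //.
have [[v v_w]|w_sigma] := pselect (exists v, rename sigma v = w); last first.
  by apply: monom_act_eq0 => v v_w; apply: w_sigma; exists v.
rewrite -v_w (monom_act_rename _ _ s_incr) monom_act_eq0 // => u u_v.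
by apply: (w_pi u); rewrite renameE u_v v_w.
Qed.

(** Both sides have the coefficient of m in f at pi.m, because increasing maps
    act injectively on monomials, and vanish at the monomials that are not of
    this form. *)
Lemma Inc_act_comp (K : fieldType) (c : nat) (sigma tau pi : nat -> nat)
    (f : KX K c) :
  increasing sigma -> increasing tau -> (forall k, pi k = sigma (tau k)) ->
  Inc_act pi f = Inc_act sigma (Inc_act tau f).
Proof.
move=> s_incr t_incr pi_eq.
have pi_incr : increasing pi by move=> j k jk; rewrite !pi_eq; apply/s_incr/t_incr.
have actE m := monom_act_comp m s_incr t_incr pi_eq.
apply/malgP => u; have [[m <-]|u_out] := pselect (exists m, monom_act pi m = u).
  have coefE := mcoeff_Inc_act (Inc_act tau f) (monom_act tau m) s_incr.
  rewrite actE (mcoeff_Inc_act f m t_incr) in coefE.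
  exact: etrans (mcoeff_Inc_act f m pi_incr) (esym coefE).
rewrite [LHS]mcoeff_outdom; last first.
  by apply/negP => /msupp_Inc_act[m _ u_m]; apply: u_out; exists m.
rewrite [RHS]mcoeff_outdom //; apply/negP => /msupp_Inc_act[_ /msupp_Inc_act[m _ ->]].
by rewrite actE => u_m; apply: u_out; exists m.
Qed.

(** * The colexicographic order on monomials *)

(** Numbering the variables column by column makes the number increase with the
    column; this is why increasing substitutions respect the order. *)
Definition var_rank (c : nat) (v : Xvar c) : nat := (v.2 * c + v.1)%N.

Lemma var_rank_lt (c : nat) (v w : Xvar c) :
  (var_rank v < var_rank w)%N = (v.2 < w.2)%N || (v.2 == w.2) && (v.1 < w.1)%N.
Proof.
case: v w => [j k] [j' k']; rewrite /var_rank /=.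
have := ltn_ord j; have := ltn_ord j'.
by case: (ltngtP k k') => [lt_k|gt_k|<-] j_c j'_c /=; nia.
Qed.

Lemma var_rank_inj (c : nat) : injective (@var_rank c).
Proof.
move=> v w eq_vw; have := var_rank_lt v w; have := var_rank_lt w v.
rewrite eq_vw ltnn; case: v w {eq_vw} => [j k] [j' k'] /= jk jk'.
have eq_k : k = k' by lia.
by rewrite eq_k; congr pair; apply/val_inj => /=; lia.
Qed.

Lemma var_rank_rename (c : nat) (pi : nat -> nat) (v w : Xvar c) :
  increasing pi -> (var_rank v < var_rank w)%N ->
  (var_rank (rename pi v) < var_rank (rename pi w))%N.
Proof.
move=> pi_incr; rewrite !var_rank_lt /= => /orP[/pi_incr-> //|].
by case/andP=> /eqP-> ->; rewrite eqxx orbT.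
Qed.

Definition colex (c : nat) (m m' : Xmonom c) : Prop :=
  exists v, (m v < m' v)%N /\
    forall w, (var_rank v < var_rank w)%N -> m w = m' w.

Lemma colex_trans (c : nat) (m1 m2 m3 : Xmonom c) :
  colex m1 m2 -> colex m2 m3 -> colex m1 m3.
Proof.
move=> [v [lt_v eq_v]] [w [lt_w eq_w]].
case: (ltngtP (var_rank v) (var_rank w)) => [vw|wv|/var_rank_inj eq_vw].
- exists w; rewrite (eq_v w vw); split=> // x wx.
  by rewrite -eq_w // eq_v // (ltn_trans vw).
- exists v; rewrite -(eq_w v wv); split=> // x vx.
  by rewrite -eq_w ?eq_v // (ltn_trans wv).
- exists v; rewrite -eq_vw in lt_w eq_w; split=> [|x vx].
    exact: ltn_trans lt_w.
  by rewrite -eq_w ?eq_v.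
Qed.

Lemma monom_bounded (c : nat) (m : Xmonom c) :
  exists N, forall v, (N <= var_rank v)%N -> m v = 0%N.
Proof.
exists (\max_(v <- finsupp (cmonom_val m)) (var_rank v).+1)%N => v.
rewrite leqNgt => v_big; apply/eqP; rewrite cmE_eq0; apply: contra v_big => v_m.
by rewrite (big_rem v) //= leq_max ltnSn.
Qed.

Lemma colex_total (c : nat) (m m' : Xmonom c) :
  [\/ m = m', colex m m' | colex m' m].
Proof.
have [N mN] := monom_bounded m; have [N' mN'] := monom_bounded m'.
have {N mN N' mN'} [N eqN] : exists N, forall v, (N <= var_rank v)%N -> m v = m' v.
  exists (maxn N N') => v; rewrite geq_max => /andP[Nv N'v].
  by rewrite mN // mN'.
elim: N eqN => [|N IHN] eqN; first by apply: Or31; apply/eqP/cmP => v; apply: eqN.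
have [[v [vN /eqP]]|eq_N] := pselect (exists v, var_rank v = N /\ m v <> m' v).
  rewrite neq_ltn => /orP[lt_v|lt_v]; [apply: Or32|apply: Or33];
    by exists v; split=> // w; rewrite vN => /eqN.
apply: IHN => v; rewrite leq_eqVlt => /predU1P[Nv|/eqN //].
by apply: contrapT => neq_v; apply: eq_N; exists v.
Qed.

(** Induction on a bound N for the variables that occur.  A monomial in the
    variables of rank at most N is controlled lexicographically by its exponent
    at the variable of rank N, if there is one, and by the monomial [trunc]
    formed by the other variables, to which the induction hypothesis applies. *)
Lemma colex_wf (c : nat) : well_founded (@colex c).
Proof.
move=> m; have [N mN] := monom_bounded m; elim: N m mN => [|N IHN] m mN.
  by split=> m' [v [+ _]]; rewrite mN.
have [[v0 v0N]|noN] := pselect (exists v : Xvar c, var_rank v = N); last first.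
  apply: IHN => v; rewrite leq_eqVlt => /predU1P[Nv|/mN //].
  by case: noN; exists v.
pose trunc (u : Xmonom c) : Xmonom c :=
  [cmonom u v | v in finsupp (cmonom_val u) `\ v0]%M.
have truncE u v : trunc u v = if v == v0 then 0%N else u v.
  rewrite cmE fsfun_fun !inE -cmE_neq0.
  by case: eqP => //= _; case: eqP => //= ->.
suff accN e (u : Xmonom c) : u v0 = e -> (forall v, (N < var_rank v)%N -> u v = 0%N) ->
    Acc (@colex c) u by apply: accN.
elim/ltn_ind: e u => e IHe u ue uN.
suff accT x : Acc (@colex c) x -> (forall v, (N <= var_rank v)%N -> x v = 0%N) ->
    forall u : Xmonom c, u v0 = e -> (forall v, v <> v0 -> u v = x v) -> Acc (@colex c) u.
  have tN v : (N <= var_rank v)%N -> trunc u v = 0%N.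
    rewrite truncE leq_eqVlt => /predU1P[Nv|/uN->]; last by case: ifP.
    by rewrite ifT //; apply/eqP/var_rank_inj; rewrite v0N.
  apply: (accT (trunc u) (IHN _ tN) tN u ue).
  by move=> v /eqP/negPf v_v0; rewrite truncE v_v0.
elim=> {ue uN u} {}x _ IHx xN u ue ux; split=> u' [v [lt_v eq_v]].
have [v_v0|v_v0] := eqVneq v v0.
  rewrite v_v0 in lt_v eq_v; rewrite ue in lt_v.
  apply: (IHe _ lt_v) => // w Nw; rewrite eq_v ?v0N // ux ?xN ?(ltnW Nw) //.
  by move=> w_v0; move: Nw; rewrite w_v0 v0N ltnn.
have vN : (var_rank v < N)%N.
  by rewrite ltnNge; apply/negP => /xN x0; move: lt_v; rewrite ux ?x0 //; apply/eqP.
have x'N w : (N <= var_rank w)%N -> trunc u' w = 0%N.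
  rewrite truncE; case: eqVneq => // w_v0 Nw.
  by rewrite eq_v ?(leq_trans vN) // ux ?xN //; apply/eqP.
apply: (IHx (trunc u') _ x'N u').
- exists v; rewrite truncE (negPf v_v0) -ux; last exact/eqP.
  split=> // w vw; rewrite truncE; case: eqVneq => [->|/eqP w_v0].
    by rewrite xN ?v0N.
  by rewrite eq_v // ux.
- by rewrite eq_v // v0N.
- by move=> w /eqP/negPf w_v0; rewrite truncE w_v0.
Qed.

Lemma colex_mul (c : nat) (w m m' : Xmonom c) :
  colex m m' -> colex (mmul w m) (mmul w m').
Proof.
move=> [v [lt_v eq_v]]; exists v; rewrite !cmM ltn_add2l; split=> // x vx.
by rewrite !cmM eq_v.
Qed.

(** The last variable where the images differ is the image of the last variable
    where m and m' differ; off the image of the variables both exponents are 0. *)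
Lemma colex_act (c : nat) (pi : nat -> nat) (m m' : Xmonom c) :
  increasing pi -> colex m m' -> colex (monom_act pi m) (monom_act pi m').
Proof.
move=> pi_incr [v [lt_v eq_v]]; exists (rename pi v).
rewrite !(monom_act_rename _ _ pi_incr); split=> // w lt_vw.
have [[x x_w]|w_out] := pselect (exists x, rename pi x = w); last first.
  by rewrite !monom_act_eq0 // => x x_w; apply: w_out; exists x.
rewrite -x_w !(monom_act_rename _ _ pi_incr) eq_v //.
move: lt_vw; rewrite -x_w; case: (ltngtP (var_rank v) (var_rank x)) => //.
  by move=> /(var_rank_rename pi_incr) xv vx; have := ltn_trans xv vx; rewrite ltnn.
by move=> /var_rank_inj->; rewrite ltnn.
Qed.

(** * Leading monomials and reduction *)

Definition leading (K : fieldType) (c : nat) (f : KX K c) (m : Xmonom c) : Prop :=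
  m \in msupp f /\ forall u, u \in msupp f -> u = m \/ colex u m.

Lemma leading_exists (K : fieldType) (c : nat) (f : KX K c) :
  f <> 0 -> exists m, leading f m.
Proof.
suff maxP (s : seq (Xmonom c)) (m0 : Xmonom c) : m0 \in s ->
    exists2 m, m \in s & forall u, u \in s -> u = m \/ colex u m.
  move=> /eqP; rewrite -msupp_eq0 => /fset0Pn[m m_f].
  by have [u u_f umax] := maxP (msupp f) m m_f; exists u.
elim: s m0 => [//|m [|m1 s] IHs] m0 _.
  by exists m => [|u]; rewrite inE ?eqxx // => /eqP->; left.
have [u u_s umax] := IHs m1 (mem_head _ _).
have [um|mu|um] := colex_total m u.
- exists u; first by rewrite inE u_s orbT.
  by move=> x; rewrite inE => /predU1P[->|/umax//]; left.
- exists u; first by rewrite inE u_s orbT.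
  by move=> x; rewrite inE => /predU1P[->|/umax//]; right.
- exists m; first by rewrite mem_head.
  move=> x; rewrite inE => /predU1P[->|/umax[->|xu]]; [by left|by right|right].
  exact: colex_trans um.
Qed.

Lemma leading_act (K : fieldType) (c : nat) (pi : nat -> nat) (f : KX K c)
    (m : Xmonom c) :
  increasing pi -> leading f m -> leading (Inc_act pi f) (monom_act pi m).
Proof.
move=> pi_incr [m_f mmax]; split.
  by rewrite -mcoeff_neq0 (mcoeff_Inc_act f m pi_incr) mcoeff_neq0.
move=> _ /msupp_Inc_act[u /mmax[->|um] ->]; first by left.
by right; apply: colex_act.
Qed.

Lemma mcoeffUM (K : fieldType) (c : nat) (a : K) (w u : Xmonom c) (g : KX K c) :
  (<< a *g w >> * g)@_(mmul w u) = a * g@_u.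
Proof.
rewrite {1}(monalgE g) mulr_sumr raddf_sum [in RHS](monalgE g) raddf_sum mulr_sumr /=.
apply: eq_bigr => x _; rewrite malgUM !mcoeffU mulrnAr; congr (_ *+ nat_of_bool _).
apply/eqP/eqP => [eq_wx|-> //]; apply/eqP/cmP => v.
by have := congr1 (fun m : Xmonom c => m v) eq_wx; rewrite !cmM => /addnI.
Qed.

Lemma leading_reduce (K : fieldType) (c : nat) (f g : KX K c) (w u : Xmonom c) :
  leading g u -> leading f (mmul w u) ->
  exists a, forall m, m \in msupp (f - << a *g w >> * g) -> colex m (mmul w u).
Proof.
move=> [u_g umax] [wu_f wumax]; exists (f@_(mmul w u) / g@_u) => m m_h.
have m_neq : m <> mmul w u.
  move=> m_wu; move: m_h.
  by rewrite m_wu -mcoeff_neq0 mcoeffB mcoeffUM divfK ?subrr ?eqxx // mcoeff_neq0.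
have /fsubsetP/(_ m m_h) := msuppB_le f (<< f@_(mmul w u) / g@_u *g w >> * g).
rewrite in_fsetU => /orP[/wumax[]//|/msuppM_le[w' [x [w'_w x_g m_wx]]]].
have w'E : w' = w by apply/fset1P/(fsubsetP msuppU_le w' w'_w).
rewrite w'E in m_wx; have [x_u|/(colex_mul w)] := umax x x_g; last by rewrite -m_wx.
by case: m_neq; rewrite m_wx x_u.
Qed.

(** Divisibility has to be checked only at the renamed variables, as pi.m
    involves no others. *)
Lemma monom_act_dvd (c : nat) (pi : nat -> nat) (m u : Xmonom c) :
  increasing pi -> (forall v, (m v <= u (rename pi v))%N) ->
  exists w, u = mmul w (monom_act pi m).
Proof.
move=> pi_incr le_mu; exists (divcm u (monom_act pi m)).
apply/eqP/cmP => v; rewrite cmM divcmE subnK //.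
have [[x <-]|v_out] := pselect (exists x, rename pi x = v).
  by rewrite (monom_act_rename _ _ pi_incr).
by rewrite monom_act_eq0 // => x x_v; apply: v_out; exists x.
Qed.

(** * Stabilization *)

Definition leading_term (K : fieldType) (c : nat) (I : nat -> KX K c -> Prop)
    (x : nat * Xmonom c) : Prop :=
  (0 < x.1)%N /\ exists f, I x.1 f /\ leading f x.2.

Definition divides_along (c i : nat) (x y : nat * Xmonom c) : Prop :=
  exists pi, Inc_mn i x.1 y.1 pi /\
    forall v, (x.2 v <= y.2 (rename pi v))%N.

(** The leading terms of the whole chain are finitely generated for
    [divides_along], in the form of a bound on the sizes of generators.  Were
    there no bound, one could choose successively leading terms divided by none
    of size at most the sizes already met: no term of this sequence divides a
    later one, against [Inc_wqo]. *)
Lemma leading_terms_bounded (K : fieldType) (c i : nat)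
    (I : nat -> KX K c -> Prop) :
  (forall n f, (0 < n)%N -> I n f -> in_KXn n f) ->
  exists r, (0 < r)%N /\ forall y, leading_term I y ->
    exists x, [/\ leading_term I x, (x.1 <= r)%N & divides_along i x y].
Proof.
move=> I_sub; apply: contrapT => /forallNP no_r.
(* The bound r.+1 is refuted rather than r, as bounds have to be positive. *)
have /choice[F FP] r : exists y, leading_term I y /\
    forall x, leading_term I x -> (x.1 <= r)%N -> ~ divides_along i x y.
  have /not_andP[//|/existsNP[y /not_implyP[y_lt no_x]]] := no_r r.+1.
  exists y; split=> // x x_lt x_r xy; apply: no_x; exists x; split=> //.
  exact: leqW.
pose r := fix r k := if k is l.+1 then maxn (r l) (F (r l)).1 else 0%N.
have r_leq : {homo r : a b / (a <= b)%N}.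
  by apply: homo_leq => // [x y z|a]; [apply: leq_trans|apply: leq_maxl].
have [||a [b [ab div_ab]]] := @Inc_wqo c i (F \o r).
- by move=> a; case: (FP (r a)).1.
- move=> a v; have [F_gt0 [f [If [lead_f _]]]] := (FP (r a)).1.
  exact: I_sub F_gt0 If _ _ lead_f.
apply: (FP (r b)).2 div_ab; first exact: (FP (r a)).1.
by apply: leq_trans (r_leq _ _ ab); apply: leq_maxr.
Qed.

Theorem corollary5p3 (K : fieldType) (c : nat) (hc : (0 < c)%N) (i : nat)
    (I : nat -> KX K c -> Prop) (hI : Inc_filtration i I) :
  stabilizes i I.
Proof.
have [I_ideal I_Inc] := hI.
have [|r [r_gt0 rP]] := @leading_terms_bounded K c i I.
  by move=> n f n_gt0; have [I_sub _ _ _] := I_ideal n n_gt0; apply: I_sub.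
exists r; split=> // n le_rn g.
have n_gt0 : (0 < n)%N by apply: leq_trans le_rn.
split=> [gen_g|Ig J J_ideal J_gen].
  by apply: gen_g => [|s]; [apply: I_ideal|apply: I_Inc].
have [I_sub _ ID IM] := I_ideal n n_gt0.
have [_ J0 JD JM] := J_ideal.
(* Equality is shown inside an arbitrary ideal J that contains the images of
   I_r, by induction on leading monomials. *)
suff Jlead m f : leading f m -> I n f -> J f.
  have [->//|/eqP/leading_exists[m g_m]] := eqVneq g 0.
  exact: Jlead g_m Ig.
elim: (colex_wf m) f => {}m _ IHm f f_m If.
have [|[d u] [[/= d_gt0 [f0 [If0 f0_u]]] le_dr [pi [pi_dn /= le_um]]]] := rP (n, m).
  by split=> //; exists f.
have pi_incr := Inc_increasing pi_dn.1.
have [w mE] := monom_act_dvd pi_incr le_um.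
pose g0 := Inc_act pi f0.
have Ig0 : I n g0.
  by apply: (I_Inc d n) => //; [apply: leq_trans le_rn|exists pi, f0].
have Jg0 : J g0.
  have [sigma [tau [tau_dr sigma_rn piE]]] := Inc_mn_factor d_gt0 le_dr le_rn pi_dn.
  apply: J_gen; exists sigma, (Inc_act tau f0); split; first exact: sigma_rn.
    by apply: (I_Inc d r) => //; exists tau, f0.
  exact: Inc_act_comp (Inc_increasing sigma_rn.1) (Inc_increasing tau_dr.1) piE.
have f_wm : leading f (mmul w (monom_act pi u)) by rewrite -mE.
have [a redP] := leading_reduce (leading_act pi_incr f0_u) f_wm.
have w_n b : in_KXn n (<< b *g w >> : KX K c).
  move=> w' v /(fsubsetP msuppU_le)/fset1P-> wv; apply: (I_sub f If m) => //.
    exact: f_m.1.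
  by rewrite mE cmM addn_eq0 (negPf wv).
pose h := f - << a *g w >> * g0.
have fE : f = h + << a *g w >> * g0 by rewrite subrK.
(* Ideals are given by sums and multiples: -1 goes into the multiplier. *)
have Ih : I n h.
  by apply: ID => //; rewrite -mulNr -monalgUN; apply: IM.
rewrite fE; apply: JD; last exact: JM.
have [->//|/eqP/leading_exists[m' h_m']] := eqVneq h 0.
by apply: (IHm m' _ h h_m' Ih); rewrite mE; apply: redP h_m'.1.
Qed.
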